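(* Let $G$ be a finite, simple, undirected, connected graph of order $n \ge 2$ with $\mathrm{bf}(G) \ge 1$. Then $$\mathrm{bf}(G)\le \frac{2}{3}\bigl(n-\dim(G)-1\bigr).$$
   Context: For vertices $u,v$ of a connected graph $G$, $d_G(u,v)$ is the number of edges in a shortest $u$–$v$ path. A vertex $x$ resolves two vertices $u,v$ if $d_G(u,x)\neq d_G(v,x)$. A set $R\subseteq V(G)$ is a resolving set of $G$ if every pair of distinct vertices of $G$ is resolved by some vertex of $R$. A metric basis of $G$ is a resolving set of smallest possible cardinality, and this cardinality is the metric dimension $\dim(G)$. A basis forced vertex of $G$ is a vertex that belongs to every metric basis of $G$; $\mathrm{bf}(G)$ denotes the number of basis forced vertices of $G$. The order of $G$ is $|V(G)|$. *)

(* Defs.v *)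
From mathcomp Require Import all_boot all_order all_algebra.

Set Implicit Arguments.
Unset Strict Implicit.
Unset Printing Implicit Defensive.

(* A finite simple graph is a symmetric irreflexive adjacency
   relation on a finite type of vertices. *)

Definition simple_graph (T : finType) (e : rel T) : Prop :=
  symmetric e /\ irreflexive e.

Definition connected_graph (T : finType) (e : rel T) : Prop :=
  forall u v : T, connect e u v.

(* The k-tuple p lists the vertices after u, so k is the number of edges. *)
Definition has_path (T : finType) (e : rel T) (u v : T) (k : nat) : bool :=
  [exists p : k.-tuple T, [&& path e u p, uniq (u :: p) & last u p == v]].

(* A path has fewer than #|T| edges, so no length is missed by the search;
   the value is #|T| when u and v are not connected. *)
Definition gdist (T : finType) (e : rel T) (u v : T) : nat :=
  find (has_path e u v) (iota 0 #|T|).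

Definition resolves (T : finType) (e : rel T) (x u v : T) : bool :=
  gdist e u x != gdist e v x.

Definition resolving_set (T : finType) (e : rel T) (R : {set T}) : bool :=
  [forall u : T, forall v : T, (u != v) ==> [exists x in R, resolves e x u v]].

(* The argmin is meaningful because the full vertex set is resolving
   (resolving_setT below). *)
Definition metric_dim (T : finType) (e : rel T) : nat :=
  #|[arg min_(R < [set: T] | resolving_set e R) #|R| ]|.

Definition metric_basis (T : finType) (e : rel T) (R : {set T}) : bool :=
  resolving_set e R && (#|R| == metric_dim e).

Definition basis_forced (T : finType) (e : rel T) (v : T) : bool :=
  [forall R : {set T}, metric_basis e R ==> (v \in R)].

Definition bf (T : finType) (e : rel T) : nat :=
  #|[set v : T | basis_forced e v]|.

Lemma gdist_le_path (T : finType) (e : rel T) (u v : T) (p : seq T) :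
  path e u p -> last u p = v -> gdist e u v <= size p.
Proof.
move=> ep; case/shortenP: ep => q eq uq sq lq.
have szq : size q <= size p.
  by move: uq => /= /andP[_ uq]; exact: uniq_leq_size uq sq.
apply: leq_trans szq.
rewrite leqNgt; apply/negP => lt.
have szT : size q < #|T| by rewrite -[(size q).+1]/(size (u :: q)) -(card_uniqP uq) max_card.
have := before_find 0 lt; rewrite nth_iota // add0n => /negbT/negP; apply.
by apply/existsP; exists (in_tuple q); rewrite /= eq lq eqxx -[_ && uniq q]/(uniq (u :: q)) uq.
Qed.

Lemma gdist_path (T : finType) (e : rel T) (u v : T) :
  connect e u v ->
  exists p, [/\ path e u p, uniq (u :: p), last u p = v & size p = gdist e u v].
Proof.
case/connectP => p ep vp.
case/shortenP: ep vp => q eq uq _ ->.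
have szT : size q < #|T| by rewrite -[(size q).+1]/(size (u :: q)) -(card_uniqP uq) max_card.
have h : has (has_path e u (last u q)) (iota 0 #|T|).
  apply/hasP; exists (size q); first by rewrite mem_iota.
  by apply/existsP; exists (in_tuple q); rewrite /= eq eqxx -[_ && uniq q]/(uniq (u :: q)) uq.
have := nth_find 0 h; move: h; rewrite has_find size_iota => h.
rewrite nth_iota // add0n => /existsP[t /and3P[et ut /eqP lt]].
by exists t; split => //; rewrite size_tuple.
Qed.

Lemma resolving_setT (T : finType) (e : rel T) :
  connected_graph e -> resolving_set e [set: T].
Proof.
move=> ce; apply/forallP => u; apply/forallP => v; apply/implyP => uv.
apply/existsP; exists u; rewrite inE /= /resolves.
have := @gdist_le_path T e u u [::] isT erefl; rewrite leqn0 => /eqP ->.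
have [[|x p] [_ _ lp <-]] // := gdist_path (ce v u).
by move: uv; rewrite -lp eqxx.
Qed.

Lemma metric_dim_min (T : finType) (e : rel T) :
  connected_graph e ->
  (exists R, metric_basis e R) /\
  (forall R, resolving_set e R -> metric_dim e <= #|R|).
Proof.
move=> /resolving_setT rT; rewrite /metric_basis /metric_dim.
case: arg_minnP => // R rR mR; split=> //.
by exists R; rewrite rR eqxx.
Qed.

(* Main.v *)
Require Import Defs.
From mathcomp Require Import all_boot all_order all_algebra.
From mathcomp Require Import zify lra.

Set Implicit Arguments.
Unset Strict Implicit.
Unset Printing Implicit Defensive.

(** Let [R] be a metric basis and [F] its set of forced vertices, and compare
the vertices outside [R] by their distance vectors to [R].  Replacing a forced
[f] in [R] by any other [w] never gives a resolving set; applied to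
well-chosen [w] this yields at least two pairs of vertices outside [R] whose
vectors differ exactly in coordinate [f].

Now delete the coordinates in [F] one after another, and count distinct
vectors.  Deleting [f] always merges some vectors.  If it reduces the count by
only one, all the pairs belonging to [f] have already been identified with one
another by the earlier deletions.  This cannot happen both for an order of
deletion and for the reverse order, since two such pairs would then agree in
every coordinate.  So each [f] costs at least 3 in the two orders together,
while each order starts from [n - dim] vectors and ends with at least one:
[3 * bf <= 2 * (n - dim - 1)]. *)

(** * Collisions of a map on a finite set *)

Lemma imset_collision_lt (X Y : finType) (h : X -> Y) (C : {set X}) (x y : X) :
  x \in C -> y \in C -> x != y -> h x = h y -> #|h @: C| < #|C|.
Proof.
move=> xC yC xy hxy; rewrite ltn_neqAle leq_imset_card andbT.
by apply: contraNneq xy => /eqP/imset_injP inj; apply/eqP/inj.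
Qed.

(** If [x'] were neither [x] nor [y], both [x] and [x'] could be dropped from [C] without shrinking
    the image, which would then be at least two smaller than [C]. *)
Lemma imset_collision2 (X Y : finType) (h : X -> Y) (C : {set X})
    (x y x' y' : X) :
  x \in C -> y \in C -> x != y -> h x = h y ->
  x' \in C -> y' \in C -> x' != y' -> h x' = h y' ->
  #|C| <= #|h @: C|.+1 -> (x' == x) || (x' == y).
Proof.
move=> xC yC xy hxy x'C y'C xy' hxy' le.
apply: contraTT le; rewrite negb_or -ltnNge => /andP[x'x x'y].
have sub : h @: C \subset h @: (C :\ x :\ x').
  apply/subsetP => _ /imsetP[z zC ->].
  have hyim : h y \in h @: (C :\ x :\ x').
    by apply: imset_f; rewrite !inE yC eq_sym x'y eq_sym xy.
  case: (eqVneq z x) => [-> | zx]; first by rewrite hxy.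
  case: (eqVneq z x') => [-> | zx']; last by apply: imset_f; rewrite !inE zx' zx.
  (* The value at [x'] is attained at [y'], or at [y] when [y'] is the dropped [x]. *)
  rewrite hxy'; case: (eqVneq y' x) => [-> | y'x]; first by rewrite hxy.
  by apply: imset_f; rewrite !inE y'C y'x eq_sym xy'.
have := leq_trans (subset_leq_card sub) (leq_imset_card _ _).
by rewrite (cardsD1 x C) xC (cardsD1 x' (C :\ x)) !inE x'x x'C /=; lia.
Qed.

(** * Vectors restricted to a set of coordinates *)

Section Vectors.
Variables (T I : finType) (D : T -> I -> nat).
Implicit Types (A : {set T}) (S : {set I}).

Definition agree S (a b : T) : bool := [forall r in S, D a r == D b r].

Lemma agreeP S a b : reflect {in S, D a =1 D b} (agree S a b).
Proof. exact: 'forall_in_eqP. Qed.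

Lemma agreeW S S' a b : S' \subset S -> agree S a b -> agree S' a b.
Proof. by move=> /subsetP sS /agreeP h; apply/agreeP => r /sS/h. Qed.

Lemma agree_sym S a b : agree S a b = agree S b a.
Proof. by apply: eq_forallb_in => r _; rewrite eq_sym. Qed.

Lemma agree_trans S a b c : agree S a b -> agree S b c -> agree S a c.
Proof. by move=> /agreeP h /agreeP k; apply/agreeP => r rS; rewrite h ?k. Qed.

(** Stands for the vector of [a] restricted to [S]. The class is taken in all of [T], so it does not
    depend on [A], and [nclasses] counts distinct restricted vectors. *)
Definition agree_class S (a : T) : {set T} := [set b | agree S a b].

Lemma agree_classP S a b : reflect (agree_class S a = agree_class S b) (agree S a b).
Proof.
apply: (iffP idP) => [ab | /setP/(_ b)]; last first.
  by rewrite !inE => ->; apply/agreeP.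
apply/setP => c; rewrite !inE; apply/idP/idP; apply: agree_trans => //.
by rewrite agree_sym.
Qed.

Definition nclasses A S : nat := #|agree_class S @: A|.

(** The map that forgets coordinates, expressed on classes: a drop in [nclasses] becomes a count of
    its collisions. *)
Definition coarsen S (C : {set T}) : {set T} := \bigcup_(c in C) agree_class S c.

Lemma coarsen_class S S' a :
  S' \subset S -> coarsen S' (agree_class S a) = agree_class S' a.
Proof.
move=> sS; apply/setP => b; apply/bigcupP/idP => [[c]|ab]; last first.
  by exists a => //; rewrite inE; apply/agreeP.
by rewrite !inE => /(agreeW sS) ac cb; apply: agree_trans cb.
Qed.

Lemma coarsen_imset A S S' :
  S' \subset S -> coarsen S' @: (agree_class S @: A) = agree_class S' @: A.
Proof.
by move=> sS; rewrite -imset_comp; apply: eq_imset => a /=; apply: coarsen_class.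
Qed.

(** Disagreement at [f] itself follows from [a != b] whenever [S] separates [A]. *)
Definition differ_only_at A S (f : I) (a b : T) : bool :=
  [&& a \in A, b \in A, a != b & agree (S :\ f) a b].

Lemma differ_only_at_sym A S f a b :
  differ_only_at A S f a b = differ_only_at A S f b a.
Proof. by rewrite /differ_only_at agree_sym eq_sym andbCA. Qed.

(** * Deleting one coordinate of a separating set *)

Section Separated.
Variables (A : {set T}) (R : {set I}).
Hypothesis sepR : {in A &, forall a b, agree R a b -> a = b}.

Lemma differ_only_at_neq f a b : differ_only_at A R f a b -> D a f != D b f.
Proof.
case/and4P=> aA bA ab /agreeP h; apply: contraNneq ab => eq_f.
apply/eqP/sepR => //; apply/agreeP => r rR.
by case: (eqVneq r f) => [-> // | rf]; apply: h; rewrite !inE rf.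
Qed.

Lemma differ_only_at_class f a b (S : {set I}) :
  differ_only_at A R f a b -> S \subset R -> f \in S ->
  [/\ agree_class S a \in agree_class S @: A,
      agree_class S b \in agree_class S @: A,
      agree_class S a != agree_class S b
    & coarsen (S :\ f) (agree_class S a) = coarsen (S :\ f) (agree_class S b)].
Proof.
move=> ab sSR fS; have nab := differ_only_at_neq ab.
case/and4P: ab => aA bA _ ab; split; rewrite ?imset_f //.
  by apply: contra nab => /eqP/agree_classP/agreeP ->.
rewrite !coarsen_class ?subD1set //; apply/agree_classP.
by apply: agreeW ab; apply: setSD.
Qed.

Lemma nclassesD1_lt f a b (S : {set I}) :
  differ_only_at A R f a b -> S \subset R -> f \in S ->
  nclasses A (S :\ f) < nclasses A S.
Proof.
move=> ab sSR fS; have [aC bC nab hab] := differ_only_at_class ab sSR fS.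
by rewrite /nclasses -(coarsen_imset A (subD1set S f)) (imset_collision_lt aC bC).
Qed.

(** A loss of at most one class leaves room for a single collision, so the class of [a'], which also
    collides, must be that of [a] or of [b]. *)
Lemma nclassesD1_tight f a b a' b' (S : {set I}) :
  differ_only_at A R f a b -> differ_only_at A R f a' b' ->
  S \subset R -> f \in S -> nclasses A S <= (nclasses A (S :\ f)).+1 ->
  agree S a' a || agree S a' b.
Proof.
move=> ab ab' sSR fS; have [aC bC nab hab] := differ_only_at_class ab sSR fS.
have [aC' bC' nab' hab'] := differ_only_at_class ab' sSR fS.
rewrite /nclasses -(coarsen_imset A (subD1set S f)) => le.
have := imset_collision2 aC bC nab hab aC' bC' nab' hab' le.
by case/orP => /eqP/agree_classP ->; rewrite ?orbT.
Qed.

(** On each of [S1] and [S2], [a'] agrees with [a] or with [b]. It is the same one both times,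
    because [f] lies in both sets and separates [a] from [b]; agreement on the union [R] is then
    equality. *)
Lemma tight_union f a b a' b' (S1 S2 : {set I}) :
  differ_only_at A R f a b -> differ_only_at A R f a' b' ->
  S1 :|: S2 = R -> f \in S1 -> f \in S2 ->
  nclasses A S1 <= (nclasses A (S1 :\ f)).+1 ->
  nclasses A S2 <= (nclasses A (S2 :\ f)).+1 ->
  (a' == a) || (a' == b).
Proof.
move=> ab ab' eR f1 f2 le1 le2.
have s1 : S1 \subset R by rewrite -eR subsetUl.
have s2 : S2 \subset R by rewrite -eR subsetUr.
have nab := differ_only_at_neq ab.
have [aA bA _ _] := and4P ab; have [aA' _ _ _] := and4P ab'.
have join c : c \in A -> agree S1 a' c -> agree S2 a' c -> a' == c.
  move=> cA /agreeP h1 /agreeP h2; apply/eqP/sepR => //; apply/agreeP => r.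
  by rewrite -eR inE => /orP[/h1|/h2].
have mixed S S' : f \in S -> f \in S' -> agree S a' a -> agree S' a' b -> false.
  move=> fS fS' /agreeP/(_ f fS) e1 /agreeP/(_ f fS') e2.
  by move: nab; rewrite -e1 -e2 eqxx.
case/orP: (nclassesD1_tight ab ab' s1 f1 le1) => h1;
  case/orP: (nclassesD1_tight ab ab' s2 f2 le2) => h2.
- by rewrite (join a).
- by have := mixed _ _ f1 f2 h1 h2.
- by have := mixed _ _ f2 f1 h2 h1.
- by rewrite (join b) ?orbT.
Qed.

(** * Counting along two opposite orders of deletion *)

(** [S1] and [S2] are the coordinates still present when [f] is deleted in the two orders. Each
    deletion loses a class; if both lost only one, [a'] and [b'] would both lie in the pair of [a]
    and [b]. *)
Lemma nclassesD1_both_orders f a b a' b' (S1 S2 : {set I}) :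
  differ_only_at A R f a b -> differ_only_at A R f a' b' ->
  [set a'; b'] != [set a; b] ->
  S1 :|: S2 = R -> f \in S1 -> f \in S2 ->
  nclasses A (S1 :\ f) + nclasses A (S2 :\ f) + 3 <=
    nclasses A S1 + nclasses A S2.
Proof.
move=> ab ab' neq eR f1 f2.
have s1 : S1 \subset R by rewrite -eR subsetUl.
have s2 : S2 \subset R by rewrite -eR subsetUr.
have lt1 := nclassesD1_lt ab s1 f1.
have lt2 := nclassesD1_lt ab s2 f2.
rewrite leqNgt; apply: contra neq => lt.
have le1 : nclasses A S1 <= (nclasses A (S1 :\ f)).+1 by lia.
have le2 : nclasses A S2 <= (nclasses A (S2 :\ f)).+1 by lia.
have ha := tight_union ab ab' eR f1 f2 le1 le2.
have ba' : differ_only_at A R f b' a' by rewrite differ_only_at_sym.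
have hb := tight_union ab ba' eR f1 f2 le1 le2.
have [_ _ nab' _] := and4P ab'.
case/orP: ha nab' => /eqP->; case/orP: hb => /eqP->; rewrite ?eqxx // => _.
by rewrite setUC.
Qed.

(** [G] is deleted first in one order and last in the reverse order. The first goes from [R] to
    [R :\: G], the second from [R :\: (F :\: G)] to [R :\: F], and each element of [G] costs at
    least 3 in total. *)
Lemma nclasses_telescope (F G : {set I}) :
  F \subset R -> G \subset F ->
  (forall f, f \in F -> exists a b a' b',
     [/\ differ_only_at A R f a b, differ_only_at A R f a' b'
       & [set a'; b'] != [set a; b]]) ->
  nclasses A (R :\: G) + nclasses A (R :\: F) + 3 * #|G| <=
    nclasses A R + nclasses A (R :\: (F :\: G)).
Proof.
move=> sFR + pairs; have [n] := ubnP #|G|; elim: n G => // n IH G' ltn.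
have [-> _ | /set0Pn[f fG']] := eqVneq G' set0.
  by rewrite cards0 !setD0 muln0 addn0.
have defG' := setD1K fG'; have := cardsD1 f G'; rewrite fG'.
have fG : f \notin G' :\ f by rewrite !inE eqxx.
move: (G' :\ f) defG' fG ltn => G <- {fG'} fG ltn /= cG.
rewrite subUset sub1set => /andP[fF sGF].
have ltG : #|G| < n by lia.
move: (IH G ltG sGF) => {}IH.
have [a [b [a' [b' [ab ab' neq]]]]] := pairs f fF.
have fR := subsetP sFR f fF.
have := nclassesD1_both_orders (S1 := R :\: G) (S2 := R :\: (F :\: (f |: G)))
  ab ab' neq.
have -> : R :\: G :\ f = R :\: (f |: G) by rewrite setDDl setUC.
have -> : (R :\: (F :\: (f |: G))) :\ f = R :\: (F :\: G).
  apply/setP => r; rewrite !inE; case: (eqVneq r f) => [->|_] //=.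
  by rewrite fF fG.
rewrite cardsU1 fG => step.
suff : nclasses A (R :\: (f |: G)) + nclasses A (R :\: (F :\: G)) + 3 <=
         nclasses A (R :\: G) + nclasses A (R :\: (F :\: (f |: G))) by lia.
apply: step; rewrite ?inE ?eqxx ?fG ?fR //.
apply/setP => r; rewrite !inE.
by case: (r \in R); case: (r \in G); case: (r \in F); case: (r == f).
Qed.

Lemma three_halves_bound (F : {set I}) :
  F \subset R -> A != set0 ->
  (forall f, f \in F -> exists a b a' b',
     [/\ differ_only_at A R f a b, differ_only_at A R f a' b'
       & [set a'; b'] != [set a; b]]) ->
  3 * #|F| + 2 <= 2 * #|A|.
Proof.
move=> sFR /set0Pn[a aA] pairs.
(* With [G = F] both orders run all the way from [R] to [R :\: F]. *)
have := nclasses_telescope sFR (subxx F) pairs.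
rewrite setDv setD0.
have : nclasses A R <= #|A| by apply: leq_imset_card.
have : 0 < nclasses A (R :\: F).
  by apply/card_gt0P; exists (agree_class (R :\: F) a); rewrite imset_f.
lia.
Qed.

End Separated.
End Vectors.

(** * Graph distance and resolving sets *)

Section Distance.
Variables (T : finType) (e : rel T).
Hypotheses (sym_e : symmetric e) (conn_e : connected_graph e).

Lemma gdist_sym u v : gdist e u v = gdist e v u.
Proof.
suff le x y : gdist e x y <= gdist e y x by apply/eqP; rewrite eqn_leq !le.
have [p [ep _ lp <-]] := gdist_path (conn_e y x).
rewrite -(size_belast y p) -size_rev; apply: gdist_le_path.
  by rewrite -lp rev_path (eq_path (e' := e)) // => a b; apply: sym_e.
by case: p lp {ep} => [|z p] /= => [<-|_] //; rewrite rev_cons last_rcons.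
Qed.

Lemma gdistxx u : gdist e u u = 0.
Proof. by apply/eqP; rewrite -leqn0; apply: (@gdist_le_path _ _ _ _ [::]). Qed.

Lemma gdist_eq0 u v : (gdist e u v == 0) = (u == v).
Proof.
apply/eqP/eqP => [|->]; last exact: gdistxx.
by have [[|x p] [_ _ <- <-]] := gdist_path (conn_e u v).
Qed.

Lemma resolving_setP (R : {set T}) :
  reflect (forall u v, agree (gdist e) R u v -> u = v) (resolving_set e R).
Proof.
apply: (iffP forallP) => [h u v /agreeP uv | h u].
  apply/eqP; apply: contraT => nuv.
  have /implyP/(_ nuv)/exists_inP[x xR] := forallP (h u) v.
  by rewrite /resolves uv ?eqxx.
apply/forallP => v; apply/implyP; apply: contraR.
move/exists_inPn => nres; apply/eqP/h/agreeP => x xR.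
by apply/eqP; move: (nres x xR); rewrite negbK.
Qed.

(** * Exchanging a forced vertex *)

(** The set [w |: (R :\ f)] has at most [#|R|] elements and misses [f]; if it were resolving, it
    would be a metric basis without [f]. *)
Lemma forced_swap (R : {set T}) f w :
  metric_basis e R -> basis_forced e f -> w != f ->
  exists u v, [/\ u != v, agree (gdist e) (R :\ f) u v
                & gdist e u w = gdist e v w].
Proof.
move=> basR /forallP forced wf.
have [rR /eqP cR] := andP basR.
have fR : f \in R by have := forced R; rewrite basR.
have : ~~ resolving_set e (w |: (R :\ f)).
  apply/negP => res; have := forced (w |: (R :\ f)).
  rewrite !inE eqxx (eq_sym f) (negPf wf) implybF /metric_basis res /=.
  rewrite eqn_leq -{1}cR (proj2 (metric_dim_min conn_e)) // andbT.
  by rewrite (cardsD1 f R) fR cardsU1 leq_add2r leq_b1.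
move=> nres.
have : [exists u, exists v, (u != v) && agree (gdist e) (w |: (R :\ f)) u v].
  apply: contraR nres => /existsPn nex; apply/resolving_setP => u v uv.
  apply/eqP; apply: contraR (nex u) => nuv.
  by apply/existsP; exists v; rewrite nuv.
case/existsP=> u /existsP[v /andP[nuv uv]]; exists u, v; split=> //.
  exact: agreeW (subsetUr _ _) uv.
by have /agreeP-> := uv; rewrite ?setU11.
Qed.

(** A vertex of [R :\ f] is at distance 0 only from itself, so neither vertex of the unresolved pair
    lies there: each is [f] or outside [R]. *)
Lemma forced_swap_cases (R : {set T}) f w :
  metric_basis e R -> basis_forced e f -> w != f ->
  (exists u v, differ_only_at (gdist e) (~: R) R f u v
               /\ gdist e u w = gdist e v w) \/
  (exists v, [/\ v \notin R, agree (gdist e) (R :\ f) f v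
               & gdist e f w = gdist e v w]).
Proof.
move=> basR forced wf; have [u [v [nuv uv uw]]] := forced_swap basR forced wf.
have out x y : x != y -> agree (gdist e) (R :\ f) x y -> (x == f) || (x \notin R).
  move=> nxy /agreeP xy; case: (eqVneq x f) => //= xf; apply/negP => xR.
  by move: nxy; rewrite eq_sym -gdist_eq0 -xy ?gdistxx // !inE xf.
have vu : agree (gdist e) (R :\ f) v u by rewrite agree_sym.
have nvu : v != u by rewrite eq_sym.
case/orP: (out _ _ nuv uv) => [/eqP uf | uR].
  subst u; right; exists v; split=> //.
  by have := out _ _ nvu vu; rewrite (negPf nvu).
case/orP: (out _ _ nvu vu) => [/eqP vf | vR]; first by subst v; right; exists u.
by left; exists u, v; rewrite /differ_only_at !inE uR vR nuv.
Qed.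

(** If an exchange yields [f] with some [v], exchanging [f] for [v] yields a pair outside [R] or [f]
    with some [v']. In the latter case [v] and [v'] agree off [f], and they differ since [f] is not
    at distance 0 from [v]. *)
Lemma forced_pair (R : {set T}) f :
  2 <= #|T| -> metric_basis e R -> basis_forced e f ->
  exists a b, differ_only_at (gdist e) (~: R) R f a b.
Proof.
move=> gt1 basR forced.
have fR : f \in R by have := forallP forced R; rewrite basR.
have [w _ wf] : exists2 w, w \in [set: T] & w != f.
  have : 0 < #|[set: T] :\ f| by have := cardsD1 f [set: T]; rewrite !inE cardsT; lia.
  by case/card_gt0P => w; rewrite !inE andbT; exists w.
case: (forced_swap_cases basR forced wf) => [[u [v [uv _]]]|[v [vR fv _]]].
  by exists u, v.
have vf : v != f by apply: contraNneq vR => ->.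
case: (forced_swap_cases basR forced vf) => [[u [v' [uv _]]]|[v' [v'R fv' d]]].
  by exists u, v'.
exists v, v'; rewrite /differ_only_at !inE vR v'R /=; apply/andP; split.
  by apply: contraNneq vf => vv'; rewrite eq_sym -gdist_eq0 d -vv' gdistxx.
by apply: agree_trans fv'; rewrite agree_sym.
Qed.

(** Assuming that [a], [b] is the only pair, exchange [f] for [a], for [b], and then for a vertex
    [v] that these exchanges produce. *)
Lemma forced_two_pairs (R : {set T}) f :
  2 <= #|T| -> metric_basis e R -> basis_forced e f ->
  exists a b a' b',
    [/\ differ_only_at (gdist e) (~: R) R f a b,
        differ_only_at (gdist e) (~: R) R f a' b'
      & [set a'; b'] != [set a; b]].
Proof.
move=> gt1 basR forced.
have fR : f \in R by have := forallP forced R; rewrite basR.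
have resR : resolving_set e R by case/andP: basR.
have [a [b ab]] := forced_pair gt1 basR forced; exists a, b.
set E := differ_only_at (gdist e) (~: R) R f in ab *.
case: (boolP [exists x, exists y, E x y && ([set x; y] != [set a; b])]).
  by case/existsP=> x /existsP[y /andP[xy neq]]; exists x, y.
move=> nex; exfalso.
have only x y : E x y -> [set x; y] = [set a; b].
  move=> xy; apply/eqP; apply: contraR nex => neq.
  by apply/existsP; exists x; apply/existsP; exists y; rewrite xy.
have dab : gdist e a f != gdist e b f.
  apply: (differ_only_at_neq (A := ~: R) (R := R)) ab => x y _ _.
  by move/resolving_setP: resR; apply.
have [+ + nab _] := and4P ab; rewrite !inE => aR bR.
(* Neither member of the pair can be equidistant from both members, so exchanging [f] for [a] or [b]
   must produce a pair containing [f]. *)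
have not_in x y z : E x y -> z \in [set a; b] -> gdist e x z = gdist e y z -> False.
  move=> xy; rewrite -(only _ _ xy) !inE => zxy d.
  have [_ _ nxy _] := and4P xy; move: nxy.
  case/orP: zxy d => /eqP-> /eqP; rewrite gdistxx ?[0 == _]eq_sym gdist_eq0.
    by rewrite eq_sym => ->.
  by move=> ->.
have nf x : x \notin R -> x != f by apply: contraNneq => ->.
have fpair x : x \in [set a; b] -> exists v,
    [/\ v \notin R, agree (gdist e) (R :\ f) f v, gdist e f x = gdist e v x
      & v != x].
  move=> xab; have xR : x \notin R by move: xab; rewrite !inE => /orP[]/eqP->.
  have [[u [v [uv d]]]|[v [vR fv d]]] := forced_swap_cases basR forced (nf x xR).
    by case: (not_in u v x uv xab d).
  exists v; split=> //; apply: contraNneq (nf x xR) => vx.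
  by rewrite eq_sym -gdist_eq0 d vx gdistxx.
have twin v v' : v \notin R -> v' \notin R -> v != v' ->
    agree (gdist e) (R :\ f) f v -> agree (gdist e) (R :\ f) f v' ->
    E v v'.
  move=> vR v'R nvv' fv fv'; rewrite /E /differ_only_at !inE vR v'R nvv' /=.
  by apply: agree_trans fv'; rewrite agree_sym.
have [v [vR fv dva va]] := fpair a (set21 a b).
have [v' [v'R fv' dvb vb]] := fpair b (set22 a b).
(* If distinct, [v] and [v'] form the only pair, so [v = b] and [v' = a]; then [f] is at the
   distance between [a] and [b] from both, against [dab]. *)
case: (eqVneq v v') => [vv' | nvv']; last first.
  have vv' := twin _ _ vR v'R nvv' fv fv'; have eq_set := only _ _ vv'.
  have : v \in [set a; b] by rewrite -eq_set set21.
  have : v' \in [set a; b] by rewrite -eq_set set22.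
  rewrite !inE (negPf va) (negPf vb) orbF /= => /eqP v'a /eqP vb'.
  move: dab; rewrite !(gdist_sym _ f) dva dvb v'a vb'.
  by rewrite (gdist_sym b) eqxx.
rewrite -vv' in dvb vb.
(* Now [v] is outside the pair and has the same distances as [f] to [a] and to [b]. If the exchange
   for [v] gives the pair [a], [b], these are equidistant from [v], hence from [f]. *)
have [[x [y [xy d]]]|[v2 [v2R fv2 d]]] := forced_swap_cases basR forced (nf v vR).
  have eq_set := only _ _ xy.
  have dv : gdist e a v = gdist e b v.
    have xab : x \in [set a; b] by rewrite -eq_set set21.
    have yab : y \in [set a; b] by rewrite -eq_set set22.
    have [_ _ nxy _] := and4P xy; move: xab yab nxy d; rewrite !inE.
    by do 2!case/orP=> /eqP->; rewrite ?eqxx.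
  by move: dab; rewrite !(gdist_sym _ f) dva dvb !(gdist_sym v) dv eqxx.
have nvv2 : v != v2.
  apply: contraNneq (nf v vR) => vv2.
  by rewrite eq_sym -gdist_eq0 d -vv2 gdistxx.
(* Otherwise [v] and [v2] form a pair that contains [v], hence a second one. *)
have := set21 v v2; rewrite (only _ _ (twin _ _ vR v2R nvv2 fv fv2)).
by rewrite !inE (negPf va) (negPf vb).
Qed.

End Distance.

(** * The bound on the number of forced vertices *)

Theorem theorem7 (T : finType) (e : rel T)
    (simple_e : simple_graph e) (connected_e : connected_graph e)
    (order_ge2 : 2 <= #|T|) (bf_ge1 : 1 <= bf e) :
  (((bf e)%:R : rat) <= 2%:R / 3%:R * (#|T|%:R - (metric_dim e)%:R - 1))%R.
Proof.
have [sym_e _] := simple_e.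
have [[R basR] _] := metric_dim_min connected_e.
have [/resolving_setP sepR /eqP cardR] := andP basR.
have pairs f : f \in [set v | basis_forced e v] -> exists a b a' b',
    [/\ differ_only_at (gdist e) (~: R) R f a b,
        differ_only_at (gdist e) (~: R) R f a' b'
      & [set a'; b'] != [set a; b]].
  by rewrite inE; apply: forced_two_pairs.
have sFR : [set v | basis_forced e v] \subset R.
  by apply/subsetP => f; rewrite inE => /forallP/(_ R); rewrite basR.
(* A forced vertex exists, and its pairs lie outside [R]. *)
have nonempty : ~: R != set0.
  have [f /pairs[a [_ [_ [_ [/and4P[aR _ _ _] _ _]]]]]] := card_gt0P bf_ge1.
  by apply/set0Pn; exists a.
have := three_halves_bound (fun a b _ _ => sepR a b) sFR nonempty pairs.
rewrite -/(bf e) => bound.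
(* The additive form avoids truncated subtraction before the passage to [rat]. *)
have {bound} : 3 * bf e + 2 * metric_dim e + 2 <= 2 * #|T|.
  by have := cardsC R; rewrite cardR; lia.
rewrite -(Num.Theory.ler_nat rat); lra.
Qed.
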